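(* Let $r\ge 1$, let $A$ be a real $r\times r$ matrix and let $R,S$ be real symmetric positive semi-definite $r\times r$ matrices such that $(A,R^{1/2})$ is controllable and $(A,S^{1/2})$ is observable. Then for any integer $n\geq r$ and any $P\in\mathcal{S}^0_r$, $$\mathcal{E}_n(P)-E^n=E^n\,\mathcal{L}_n(P)^{-1}(P-P_{\infty})\,G_n,$$ where $\mathcal{L}_n(P):=I+(P-P_\infty)G_n$.
   Context: All matrices are real $r\times r$; $M'$ denotes the transpose of $M$. $\mathcal{S}^0_r$ is the set of symmetric positive semi-definite matrices. $R^{1/2}$, $S^{1/2}$ are symmetric square roots of $R,S$. Controllability of $(A,R^{1/2})$ means that $[R^{1/2},AR^{1/2},\ldots,A^{r-1}R^{1/2}]$ has rank $r$; observability of $(A,S^{1/2})$ means that the matrix obtained by stacking $S^{1/2},S^{1/2}A,\ldots,S^{1/2}A^{r-1}$ vertically has rank $r$. For $P,Q\in\mathcal{S}^0_r$ the matrix $I+PQ$ is invertible. The Riccati map $\Phi:\mathcal{S}^0_r\to\mathcal{S}^0_r$ is $\Phi(P):=A(I+PS)^{-1}PA'+R$. It is a well-known fact that, when $(A,R^{1/2})$ is controllable and $(A,S^{1/2})$ is observable, $\Phi$ has a unique positive definite fixed point $P_\infty=\Phi(P_\infty)$, and that $E:=A(I+P_\infty S)^{-1}$ has spectral radius strictly less than $1$. For $P\in\mathcal{S}^0_r$: $\mathcal{E}(P):=A(I+PS)^{-1}$, and $\mathcal{E}_n(P)$ is defined by $\mathcal{E}_0(P)=I$, $\mathcal{E}_{n+1}(P)=\mathcal{E}_n(\Phi(P))\,\mathcal{E}(P)$.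 Set $F:=S(I+P_\infty S)^{-1}$. The Gramians $G_n$ are defined by $G_0=0$, $G_n=E'G_{n-1}E+F$ for $n\ge 1$, i.e. $G_n=\sum_{0\le k<n}(E')^kFE^k$. For $n\ge r$ and $P\in\mathcal{S}^0_r$ the matrix $\mathcal{L}_n(P)$ is invertible.
   Formalization: The displayed identity is false as printed (r=n=1, A=S=1, R=9/4, P∞=3, P=0 gives 3/4 on the left and -3/4 on the right); the theorem proved has a minus sign in front of the right-hand side. *)

(* Defs.v *)
From mathcomp Require Import all_boot all_order all_algebra.
From mathcomp Require Import reals.
Set Implicit Arguments.
Unset Strict Implicit.
Unset Printing Implicit Defensive.
Import Order.TTheory GRing.Theory Num.Theory.
Local Open Scope ring_scope.

Section Riccati.
Variables (K : realType) (r : nat).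
Implicit Types A R S P Q M : 'M[K]_r.

Definition psdmx M : Prop :=
  M^T = M /\ forall x : 'cV[K]_r, 0 <= (x^T *m M *m x) 0 0.

Definition posdefmx M : Prop :=
  M^T = M /\ forall x : 'cV[K]_r, x != 0 -> 0 < (x^T *m M *m x) 0 0.

(* Nonnegativity is not required of the root: a symmetric Q with Q Q = M has
   the same column space as M, so the rank conditions below do not depend on
   which symmetric root is taken. *)
Definition sym_sqrtmx M Q : Prop := Q^T = Q /\ Q *m Q = M.

Definition controllable A Q : Prop :=
  \rank (\mxrow_(k < r) (A ^+ k *m Q)) = r.

Definition observable A Q : Prop :=
  \rank (\mxcol_(k < r) (Q *m A ^+ k)) = r.

Definition Phi A R S P : 'M[K]_r :=
  A *m invmx (1%:M + P *m S) *m P *m A^T + R.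

Definition calE A S P : 'M[K]_r := A *m invmx (1%:M + P *m S).

Fixpoint calEn A R S (n : nat) P : 'M[K]_r :=
  if n is m.+1 then calEn A R S m (Phi A R S P) *m calE A S P else 1%:M.

Definition calF S P : 'M[K]_r := S *m invmx (1%:M + P *m S).

Fixpoint gramian A S Pinf (n : nat) : 'M[K]_r :=
  if n is m.+1
  then (calE A S Pinf)^T *m gramian A S Pinf m *m calE A S Pinf + calF S Pinf
  else 0.

(* One has calEn n P *m calL n P = E ^+ n with E := calE A S Pinf.  Subtracting
   E ^+ n gives calEn n P - E ^+ n
     = - E ^+ n *m (calL n P)^-1 *m (P - Pinf) *m gramian n,
   with a minus sign.  The source prints this corollary without it, which is
   false already for r = n = 1, A = S = 1, R = 9/4, Pinf = 3, P = 0: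
   the left-hand side is 3/4, the printed right-hand side is -3/4. *)
Definition calL A S Pinf (n : nat) P : 'M[K]_r :=
  1%:M + (P - Pinf) *m gramian A S Pinf n.

End Riccati.

(* Main.v *)
Require Import Defs.
From mathcomp Require Import all_boot all_order all_algebra.
From mathcomp Require Import reals.
Import Order.TTheory GRing.Theory Num.Theory.
Local Open Scope ring_scope.

(** Write [T_P = (I + P S)^-1], so that [calE P = A T_P].  The resolvent-type
    identity [T_P P - T_Q Q = T_P (P - Q) T_Q'] gives both
    [Phi P - Phi Q = calE P (P - Q) (calE Q)'] and, by induction on [n],
    [calE_n P * L_n P = E ^ n].  The same identity yields
    [T_P L_{n+1} P = (I + (T_P P - T_Pinf Pinf) A' G_n A) T_Pinf],
    and [I + (T_P P - T_Pinf Pinf) A' G_n A] is invertible as soon as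
    [I + A (T_P P - T_Pinf Pinf) A' G_n = L_n (Phi P)] is, since [I + X Y] and
    [I + Y X] are invertible together.  Hence every [L_n P] is invertible, for
    all [n], and multiplying [calE_n P * L_n P = E ^ n] by its inverse
    concludes. *)

Set Implicit Arguments.

(** The inverse is explicit: [(I + Y X)^-1 = I - Y (I + X Y)^-1 X]. *)
Lemma unitmx_1D_mulC (K : comUnitRingType) (m n : nat)
    (X : 'M[K]_(m, n)) (Y : 'M[K]_(n, m)) :
  1%:M + X *m Y \in unitmx -> 1%:M + Y *m X \in unitmx.
Proof.
move=> u; set Z := invmx (1%:M + X *m Y).
suff /mulmx1_unit[] : (1%:M + Y *m X) *m (1%:M - Y *m Z *m X) = 1%:M by [].
have eZ : Y *m Z *m X + Y *m X *m (Y *m Z *m X) = Y *m X.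
  transitivity (Y *m ((1%:M + X *m Y) *m Z) *m X).
    by rewrite !(mulmxDl, mulmxDr, mul1mx, mulmx1, mulmxA).
  by rewrite mulmxV // mulmx1.
by rewrite mulmxBr mulmx1 mulmxDl mul1mx eZ addrK.
Qed.

Lemma psdmxD (K : realType) (r : nat) (M N : 'M[K]_r) :
  psdmx M -> psdmx N -> psdmx (M + N).
Proof.
move=> [sM pM] [sN pN]; split; first by rewrite linearD /= sM sN.
by move=> x; rewrite mulmxDr mulmxDl mxE addr_ge0.
Qed.

Lemma psdmx_congr (K : realType) (r : nat) (B M : 'M[K]_r) :
  psdmx M -> psdmx (B *m M *m B^T).
Proof.
move=> [sM pM]; split; first by rewrite !trmx_mul trmxK sM mulmxA.
by move=> x; have := pM (B^T *m x); rewrite trmx_mul trmxK !mulmxA.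
Qed.

Lemma posdefmx_psd (K : realType) (r : nat) (M : 'M[K]_r) :
  posdefmx M -> psdmx M.
Proof.
move=> [sM pM]; split=> // x; have [->|x0] := eqVneq x 0.
  by rewrite mulmx0 mxE.
exact/ltW/pM.
Qed.

Lemma trmx_mul_self_ge0 (K : realType) (r : nat) (x : 'cV[K]_r) :
  0 <= (x^T *m x) 0 0.
Proof. by rewrite mxE sumr_ge0 // => i _; rewrite mxE -expr2 sqr_ge0. Qed.

Lemma trmx_mul_self_eq0 (K : realType) (r : nat) (x : 'cV[K]_r) :
  (x^T *m x) 0 0 = 0 -> x = 0.
Proof.
rewrite mxE => /eqP; rewrite psumr_eq0 => [/allP x0|i _]; last first.
  by rewrite mxE -expr2 sqr_ge0.
apply/matrixP => i j; rewrite (ord1 j) [RHS]mxE.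
have := x0 i (mem_index_enum i).
by rewrite /= mxE -expr2 sqrf_eq0 => /eqP.
Qed.

Section RiccatiFlow.
Variables (K : realType) (r : nat) (A R S Sh : 'M[K]_r).
Hypotheses (R_psd : psdmx R) (S_psd : psdmx S) (Sh_sqrt : sym_sqrtmx S Sh).
Implicit Types P Q : 'M[K]_r.

Local Notation T P := (invmx (1%:M + P *m S)).

Lemma unitmx_1D_psd P : psdmx P -> 1%:M + P *m S \in unitmx.
Proof.
move=> [_ pP]; have [sSh SSh] := Sh_sqrt; have [sS _] := S_psd.
rewrite -unitmx_tr -row_free_unit -kermx_eq0; apply/eqP/row_matrixP => i.
rewrite row0; have := sub_kermxP (row_sub i (kermx (1%:M + P *m S)^T)).
set u := row i _ => /(congr1 trmx); rewrite trmx0 trmx_mul trmxK.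
set x := u^T => /eqP; rewrite mulmxDl mul1mx addr_eq0 => /eqP ex.
suff x0 : x = 0 by rewrite -(trmxK u) -/x x0 trmx0.
(* [|Sh x|^2 = x' S x = - (S x)' P (S x) <= 0], so [S x = 0]. *)
have Shx0 : Sh *m x = 0.
  apply/trmx_mul_self_eq0/le_anti; rewrite trmx_mul_self_ge0 andbT.
  rewrite trmx_mul sSh -mulmxA (mulmxA Sh) SSh mulmxA.
  rewrite {2}ex mulmxN mxE oppr_le0.
  by have := pP (S *m x); rewrite trmx_mul sS !mulmxA.
by rewrite ex -SSh -!mulmxA Shx0 !mulmx0 oppr0.
Qed.

Lemma trmx_1D P : psdmx P -> (1%:M + P *m S)^T = 1%:M + S *m P.
Proof.
by move=> [sP _]; rewrite linearD /= trmx1 trmx_mul sP (proj1 S_psd).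
Qed.

(** Since [(T P)^T = (I + S P)^-1] and [P + P S P = P (I + S P)], the product [T P *m P] is the
    congruence by [T P] of a sum of two psd matrices. *)
Lemma resolvent_psd P : psdmx P -> psdmx (T P *m P).
Proof.
move=> hP; have uP := unitmx_1D_psd hP.
suff -> : T P *m P = T P *m (P + P *m S *m P^T) *m (T P)^T.
  apply/psdmx_congr/psdmxD/psdmx_congr => //.
have [sP _] := hP; rewrite sP trmx_inv trmx_1D //.
have -> : P + P *m S *m P = P *m (1%:M + S *m P).
  by rewrite mulmxDr mulmx1 mulmxA.
by rewrite !mulmxA mulmxK // -trmx_1D // unitmx_tr.
Qed.

(** By symmetry [T Q *m Q = Q *m (T Q)^T]; it then suffices to write
    [P - Q = P (I + S Q) - (I + P S) Q] and cancel on each side. *)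
Lemma resolventB P Q : psdmx P -> psdmx Q ->
  T P *m P - T Q *m Q = T P *m (P - Q) *m (T Q)^T.
Proof.
move=> hP hQ; have uP := unitmx_1D_psd hP; have uQ := unitmx_1D_psd hQ.
have uQ' : 1%:M + S *m Q \in unitmx by rewrite -trmx_1D // unitmx_tr.
have [sTQ _] := resolvent_psd hQ.
rewrite -[T Q *m Q]sTQ trmx_mul (proj1 hQ) trmx_inv trmx_1D //.
have -> : P - Q = P *m (1%:M + S *m Q) - (1%:M + P *m S) *m Q.
  by rewrite mulmxDr mulmxDl mulmx1 mul1mx mulmxA [Q + _]addrC addrKA.
by rewrite mulmxBr mulmxBl !mulmxA mulmxK // mulVmx // mul1mx.
Qed.

Lemma Phi_psd P : psdmx P -> psdmx (Phi A R S P).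
Proof.
move=> hP; apply: psdmxD => //; rewrite -(mulmxA A).
exact/psdmx_congr/resolvent_psd.
Qed.

Lemma PhiB P Q :
  Phi A R S P - Phi A R S Q = A *m (T P *m P - T Q *m Q) *m A^T.
Proof. by rewrite /Phi [_ + R in X in _ - X]addrC addrKA mulmxBr mulmxBl !mulmxA. Qed.

Variable Pinf : 'M[K]_r.
Hypotheses (Pinf_psd : psdmx Pinf) (Pinf_fixed : Phi A R S Pinf = Pinf).

Local Notation E := (calE A S Pinf).
Local Notation G n := (gramian A S Pinf n).
Local Notation L n P := (calL A S Pinf n P).

Lemma resolvent_calLS n P : psdmx P ->
  T P *m L n.+1 P
  = (1%:M + (T P *m P - T Pinf *m Pinf) *m (A^T *m G n *m A)) *m T Pinf.
Proof.
move=> hP; have uP := unitmx_1D_psd hP; have uI := unitmx_1D_psd Pinf_psd.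
(* The [calF] summand of the Gramian turns [T P] into [T Pinf]; the other summand starts with
   [E^T = (T Pinf)^T *m A^T], which supplies the right factor needed by [resolventB]. *)
have eF : T P *m (1%:M + (P - Pinf) *m calF S Pinf) = T Pinf.
  have -> : 1%:M + (P - Pinf) *m calF S Pinf = (1%:M + P *m S) *m T Pinf.
    have -> : 1%:M + P *m S = (1%:M + Pinf *m S) + (P - Pinf) *m S.
      by rewrite mulmxBl -addrA [Pinf *m S + _]addrC subrK.
    by rewrite mulmxDl mulmxV // /calF mulmxA.
  by rewrite mulKmx.
rewrite /calL /= [E^T *m _ *m _ + _]addrC.
rewrite [(P - Pinf) *m _]mulmxDr addrA mulmxDr eF.
by rewrite resolventB // mulmxDl mul1mx /calE trmx_mul !mulmxA.
Qed.

Lemma calL_PhiE n P :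
  L n (Phi A R S P)
  = 1%:M + A *m ((T P *m P - T Pinf *m Pinf) *m (A^T *m G n)).
Proof. by rewrite /calL -{1}Pinf_fixed PhiB !mulmxA. Qed.

Lemma calL_unit n P : psdmx P -> L n P \in unitmx.
Proof.
elim: n P => [|n IHn] P hP; first by rewrite /calL /= mulmx0 addr0 unitmx1.
have := IHn _ (Phi_psd hP); rewrite calL_PhiE => /unitmx_1D_mulC u.
have : T P *m L n.+1 P \in unitmx.
  rewrite resolvent_calLS // unitmx_mul unitmx_inv (unitmx_1D_psd Pinf_psd).
  by rewrite andbT mulmxA.
by rewrite unitmx_mul => /andP[].
Qed.

Lemma calEn_calL n P : psdmx P -> calEn A R S n P *m L n P = E ^+ n.
Proof.
elim: n P => [|n IHn] P hP.
  by rewrite /calL /= mulmx0 addr0 mulmx1 expr0.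
rewrite exprSr -(IHn _ (Phi_psd hP)) /= -mulmxE -!mulmxA; congr (_ *m _).
(* What remains is [A (I + Y A) = (I + A Y) A], times [T Pinf], with
   [Y = (T P *m P - T Pinf *m Pinf) A^T G_n]. *)
rewrite resolvent_calLS // calL_PhiE /calE.
by rewrite !(mulmxDl, mulmxDr, mul1mx, mulmx1, mulmxA).
Qed.

End RiccatiFlow.

Unset Implicit Arguments.

Theorem corollary1p5 (K : realType) (r : nat) (A R S Rh Sh Pinf : 'M[K]_r)
    (r_ge1 : (1 <= r)%N)
    (R_psd : psdmx R) (S_psd : psdmx S)
    (Rh_sqrt : sym_sqrtmx R Rh) (Sh_sqrt : sym_sqrtmx S Sh)
    (A_Rh_controllable : controllable A Rh)
    (A_Sh_observable : observable A Sh)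
    (Pinf_posdef : posdefmx Pinf) (Pinf_fixed : Phi A R S Pinf = Pinf)
    (n : nat) (n_ge_r : (r <= n)%N) (P : 'M[K]_r) (P_psd : psdmx P) :
  calEn A R S n P - calE A S Pinf ^+ n
  = - (calE A S Pinf ^+ n *m invmx (calL A S Pinf n P) *m (P - Pinf)
       *m gramian A S Pinf n).
Proof.
have Pinf_psd := posdefmx_psd Pinf_posdef.
have uL : calL A S Pinf n P \in unitmx.
  exact: (calL_unit R_psd S_psd Sh_sqrt).
have eL : calEn A R S n P *m calL A S Pinf n P = calE A S Pinf ^+ n.
  exact: (calEn_calL R_psd S_psd Sh_sqrt).
(* The minus sign comes from [I - L_n = - (P - Pinf) G_n], multiplied on the left by [calEn]. *)
by rewrite -eL mulmxK // /calL mulmxDr mulmx1 mulmxA opprD addNKr.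
Qed.
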